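(* Let $A,B\in \operatorname{End}(I)$ be such that $$A^{p^{\eta}}=\operatorname{Id},\qquad p^{\eta}B=0\qquad\text{and}\qquad [B,A]=BAB+p^{\nu}AB. \tag{i}$$ Then the maps $\diamond\colon H\times I\to I$ and $\prec\colon I\times H\to I$ defined by $$1^{\times l}\diamond y:=A^{l}y\qquad\text{and}\qquad y\prec h:=hBy \tag{ii}$$ (for $l\in\mathbb{Z}/p^{\eta}\mathbb{Z}$, $h\in H$, $y\in I$) satisfy the following conditions, for all $h,h'\in H$ and $y,y'\in I$, where $y\triangleleft h:=h\diamond(y-y\prec h)$ and $y^{h}:=h^{\times -1}\diamond(y\triangleleft h)$: $$y\triangleleft(h\times h')=(y\triangleleft h)\triangleleft h',\quad (y+y')\triangleleft h=y\triangleleft h+y'\triangleleft h,\quad y\triangleleft 0=y, \tag{iii}$$ $$(h'\times h)\diamond y=h\diamond(h'\diamond y),\quad h\diamond(y+y')=h\diamond y+h\diamond y',\quad 0\diamond y=y, \tag{iv}$$ $$y^{h+h'}+y=y^{h}+y^{h'},\quad 0^{h}=0. \tag{v}$$ Conversely, if $\diamond\colon H\times I\to I$ and $\prec\colon I\times H\to I$ are operations that satisfy (iii), (iv) and (v), then the maps $A,B\colon I\to I$ defined by $Ay:=1\diamond y$ and $By:=y\prec 1$ are endomorphisms of $I$ that satisfy (i) and (ii).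
   Context: Let $p$ be a prime and let $\nu,\eta$ be integers with $0<\nu\le\eta\le 2\nu$; assume that $p$ is odd, or that $p=2$ and $(\nu,\eta)\ne(1,2)$. Let $H=\mathbb{Z}/p^{\eta}\mathbb{Z}$ with its usual sum, and with the operations $i\cdot j:=(1-p^{\nu}i)j$ (which makes $H$ a linear cycle set) and $i\times j:=i+j+p^{\nu}ij$. Under the hypotheses, $(H,\times)$ is a cyclic group with neutral element $0$, generated by $1$; $h^{\times -1}$ is the inverse of $h$ in $(H,\times)$ and $1^{\times l}$ is the $l$-th power of $1$ in $(H,\times)$, so every $h\in H$ is $1^{\times l}$ for a unique $l\in\mathbb{Z}/p^{\eta}\mathbb{Z}$. $I$ is an abelian group, $\operatorname{End}(I)$ is its ring of group endomorphisms, and $[B,A]:=BA-AB$. *)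

(* Defs.v *)
From mathcomp Require Import all_boot all_order all_algebra.
From mathcomp Require Import ring.

Set Implicit Arguments.
Unset Strict Implicit.
Unset Printing Implicit Defensive.

Import GRing.Theory.
Local Open Scope ring_scope.

Section CycleSet.
Variables p nu eta : nat.

(* The 'Z_ encoding needs 1 < p ^ eta, which holds for p prime and 0 < eta. *)
Definition H := 'Z_(p ^ eta)%N.

Definition htimes (i j : H) : H := i + j + (p ^ nu)%:R * i * j.

Definition hpow (h : H) (l : nat) : H := iter l (htimes h) 0.

(* The default value 0 is never used when 0 < nu and p is prime: see
   [htimes_eq0] below. *)
Definition hinv (h : H) : H := odflt 0 [pick k | htimes h k == 0].

Lemma htimesA : associative htimes.
Proof. by move=> i j k; rewrite /htimes; ring. Qed.

Lemma htimesC : commutative htimes.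
Proof. by move=> i j; rewrite /htimes; ring. Qed.

Lemma htimes0h : left_id 0 htimes.
Proof. by move=> i; rewrite /htimes; ring. Qed.

Lemma htimes_eq0 (h k : H) :
  prime p -> (0 < nu)%N -> (0 < eta)%N -> (htimes h k == 0) = (k == hinv h).
Proof.
move=> pP nu0 eta0.
have q1 : (1 < p ^ eta)%N.
  by rewrite -(exp1n eta) ltn_exp2r // prime_gt1.
pose u : H := 1 + (p ^ nu)%:R * h.
have uU : u \is a GRing.unit.
  rewrite /u -[h]natr_Zp -natrM -(natrD _ 1) unitZpE //.
  rewrite coprime_pexpl // addnC -(prednK nu0) expnS -mulnA mulnC.
  by rewrite /coprime gcdnMDl gcdn1.
have htE j : htimes h j = h + u * j by rewrite /htimes /u; ring.
have inj j : (htimes h j == 0) = (j == - h / u).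
  rewrite htE addrC addr_eq0; apply/eqP/eqP => [<-|->].
    by rewrite mulrC mulKr.
  by rewrite mulrC divrK.
rewrite inj /hinv; case: pickP => [j|/(_ (- h / u))] /=.
  by rewrite inj => /eqP ->.
by rewrite inj eqxx.
Qed.

Section Operations.
Variable I : zmodType.

(* Endomorphisms are given by their underlying maps I -> I, so that products
   in End(I) are compositions and A ^ l is [iter l A]. *)
Definition cond_i (A B : I -> I) : Prop :=
  [/\ forall y, iter (p ^ eta) A y = y,
      forall y, B y *+ (p ^ eta) = 0
    & forall y, B (A y) - A (B y) = B (A (B y)) + A (B y) *+ (p ^ nu)].

(* A class of integers modulo p ^ eta acts through its representative in
   [0, p ^ eta[, by the coercion from H to nat. *)
Definition cond_ii (A B : I -> I) (dia : H -> I -> I) (prec : I -> H -> I) :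
    Prop :=
  (forall (l : 'Z_(p ^ eta)%N) y, dia (hpow 1 l) y = iter l A y) /\
  (forall y (h : H), prec y h = B y *+ h).

Variables (dia : H -> I -> I) (prec : I -> H -> I).

Definition tri (y : I) (h : H) : I := dia h (y - prec y h).

Definition ysup (y : I) (h : H) : I := dia (hinv h) (tri y h).

Definition cond_iii : Prop :=
  [/\ forall y h h', tri y (htimes h h') = tri (tri y h) h',
      forall y y' h, tri (y + y') h = tri y h + tri y' h
    & forall y, tri y 0 = y].

Definition cond_iv : Prop :=
  [/\ forall h h' y, dia (htimes h' h) y = dia h (dia h' y),
      forall h y y', dia h (y + y') = dia h y + dia h y'
    & forall y, dia 0 y = y].

Definition cond_v : Prop :=
  (forall y h h', ysup y (h + h') + y = ysup y h + ysup y h') /\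
  (forall h, ysup 0 h = 0).

End Operations.
End CycleSet.

(* Main.v *)
(* Put T := A (1 - B).  Condition (i) says B T = (1 + p^nu) A B, whence, by
   induction, T^l = A^l (1 - 1^{x l} B): the map y <| 1^{x l} is the l-th power
   of T, and (iii) follows.  Since h^{x -1} <> (h <> z) = z, one has
   y^h = y - (y -< h), so (v) says that -< is additive in h.  Conversely, (i)
   is (iii) for h = h' = 1, since 1 x 1 = 2 + p^nu.
   That 1 generates (H, x) comes from 1^{x d} = d + p^nu C(d, 2), valid since
   p^(2 nu) = 0 in H.  If p is odd, twice this is d (2 + p^nu (d - 1)); if p = 2
   and nu > 1, it is d (1 + 2^(nu - 1) (d - 1)); if nu = eta, it is d.  In each
   case the cofactor is a unit, so 1^{x d} = 0 forces p^eta to divide d. *)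
Require Import Defs.
From mathcomp Require Import all_boot all_order all_algebra.
From mathcomp Require Import ring zify.

Set Implicit Arguments.
Unset Strict Implicit.
Unset Printing Implicit Defensive.

Import GRing.Theory.
Local Open Scope ring_scope.

(** * The group (H, x) is cyclic of order q, generated by 1 *)

Section CyclicGroup.
Variables p nu eta : nat.
Hypothesis p_pr : prime p.
Hypothesis nu_gt0 : (0 < nu)%N.
Hypothesis le_nu_eta : (nu <= eta)%N.

Local Notation q := (p ^ eta)%N.
Local Notation H := (H p eta).
Local Notation htimes := (@htimes p nu eta).
Local Notation hpow := (@hpow p nu eta).
Local Notation hinv := (@hinv p nu eta).

Lemma order_gt1 : (1 < q)%N.
Proof.
by rewrite -(exp1n eta) ltn_exp2r ?prime_gt1 // (leq_trans nu_gt0).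
Qed.

Lemma ltn_H (h : H) : (h < q)%N.
Proof. by case: h => m /=; rewrite Zp_cast ?order_gt1. Qed.

Lemma natr_H_eq0 n : ((n%:R : H) == 0) = (q %| n)%N.
Proof. by rewrite -val_eqE /= val_Zp_nat ?order_gt1. Qed.

Lemma htimesh0 (h : H) : htimes h 0 = h.
Proof. by rewrite htimesC htimes0h. Qed.

Lemma htimes_hinv (h : H) : htimes h (hinv h) = 0.
Proof. by apply/eqP; rewrite htimes_eq0 // (leq_trans nu_gt0). Qed.

Lemma htimesI (h k k' : H) : htimes h k = htimes h k' -> k = k'.
Proof.
move=> /(congr1 (htimes (hinv h))).
by rewrite !htimesA ![htimes (hinv h) h]htimesC htimes_hinv !htimes0h.
Qed.

Lemma hpowD (h : H) l m : hpow h (l + m) = htimes (hpow h l) (hpow h m).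
Proof.
elim: l => [|l IHl]; first by rewrite htimes0h.
by rewrite addSn /hpow !iterS -/(hpow _ _) IHl htimesA.
Qed.

Hypothesis le_eta_2nu : (eta <= 2 * nu)%N.

(** Multiplying h by 1 gives 1 + h + p^nu h. Since p^(2 nu) = 0 in H, p^nu h is just p^nu l when h =
    1^{x l}, and Pascal's rule closes the induction. *)
Lemma hpow1E l : hpow 1 l = (l + p ^ nu * 'C(l, 2))%:R.
Proof.
have sq0 : (p ^ nu)%:R * (p ^ nu)%:R = 0 :> H.
  apply/eqP; rewrite -natrM natr_H_eq0 -expnD dvdn_exp2l //.
  by rewrite addnn -mul2n.
elim: l => [|l IHl]; first by rewrite bin0n muln0.
rewrite /hpow iterS -/(hpow _ _) IHl /Defs.htimes binS bin1.
rewrite !(natrD, natrM) -[l.+1%:R]natr1 mulr1 [_ * (l%:R + _)]mulrDr mulrA sq0.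
ring.
Qed.

Hypothesis p_hyp : odd p \/ p = 2%N /\ (nu, eta) <> (1%N, 2%N).

Lemma hpow1_eq0 d : hpow 1 d = 0 -> (q %| d)%N.
Proof.
move/eqP; rewrite hpow1E natr_H_eq0 => q_dvd.
have bin2M : ('C(d, 2) * 2 = d * d.-1)%N.
  rewrite bin2 muln2 -[RHS]odd_double_half oddM.
  by case: (d) => //= e; case: odd.
have p_dvd : (p %| p ^ nu)%N by rewrite dvdn_exp.
(* As p divides r, the cofactor c + r (d - 1) is congruent to c modulo p, hence prime to q. *)
have cancel_unit c r : (p %| r)%N -> coprime p c ->
    (q %| d * (c + r * d.-1))%N -> (q %| d)%N.
  move=> p_r co_p_c; rewrite Gauss_dvdl // coprimeXl //.
  by rewrite -(divnK p_r) addnC mulnAC /coprime gcdnMDl.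
case: p_hyp => [odd_p | [p2 nu_eta]].
  apply: (cancel_unit 2%N (p ^ nu)%N) => //; first by rewrite coprimen2.
  suff -> : (d * (2 + p ^ nu * d.-1) = (d + p ^ nu * 'C(d, 2)) * 2)%N.
    exact: dvdn_mulr.
  by rewrite mulnDl -mulnA bin2M mulnDr mulnCA.
(* For nu = 1, eta is 1 or 2 and the excluded pair leaves eta = 1; then q = p^nu divides the
   binomial term. *)
have [nu_lt2 | nu_ge2] := ltnP nu 2.
  have nu1 : nu = 1%N by lia.
  have eta_neq2 : eta <> 2%N by move=> eta2; apply: nu_eta; rewrite nu1 eta2.
  have eq_nu_eta : nu = eta by lia.
  by rewrite eq_nu_eta dvdn_addl // dvdn_mulr in q_dvd.
apply: (cancel_unit 1%N (p ^ nu.-1)%N).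
- by rewrite dvdn_exp //; lia.
- exact: coprimen1.
suff -> : (d * (1 + p ^ nu.-1 * d.-1) = d + p ^ nu * 'C(d, 2))%N by [].
have -> : (p ^ nu * 'C(d, 2) = p ^ nu.-1 * (d * d.-1))%N.
  by rewrite -{1}(prednK nu_gt0) expnSr -bin2M p2 -mulnA [(2 * _)%N]mulnC.
by rewrite mulnDr muln1 mulnCA.
Qed.

(** Cancelling 1^{x l} from 1^{x m} leaves 1^{x (m - l)} = 0 with m - l < q, so m = l. Finiteness of
    H gives surjectivity. *)
Lemma hpow1_bij : bijective (fun l : H => hpow 1 l).
Proof.
have inj_le (l m : H) : (l <= m)%N -> hpow 1 l = hpow 1 m -> l = m.
  move=> le_lm; rewrite -(subnKC le_lm) hpowD -{1}[hpow 1 l]htimesh0.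
  move=> /htimesI/esym/hpow1_eq0/dvdn_leq le_q; apply: val_inj => /=.
  have lt_m := ltn_H m.
  by have [|/le_q] := posnP (m - l); lia.
apply: injF_bij => l m eq_lm.
by case/orP: (leq_total l m) => le; [|symmetry]; apply: inj_le.
Qed.

Lemma hpow1_order : hpow 1 q = 0.
Proof.
have [log _ logK] := hpow1_bij.
(* By surjectivity 1^{x q} = 1^{x l} with l < q. Then 1^{x (q - l)} = 0, so q divides q - l > 0,
   which forces l = 0. *)
have := logK (hpow 1 q); set l := log _ => eq_l.
have lt_l := ltn_H l.
have: hpow 1 (q - l) = 0.
  apply: (@htimesI (hpow 1 l)).
  by rewrite -hpowD subnKC ?(ltnW lt_l) // htimesh0.
move=> /hpow1_eq0/dvdn_leq; rewrite subn_gt0 => /(_ lt_l) le_q.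
suff l0 : nat_of_ord l = 0%N by rewrite -eq_l l0.
lia.
Qed.

Lemma hpow1_mod n : hpow 1 (n %% q) = hpow 1 n.
Proof.
rewrite [in RHS](divn_eq n q) hpowD.
suff -> : hpow 1 (n %/ q * q) = 0 by rewrite htimes0h.
by elim: (n %/ q)%N => // k IHk; rewrite mulSn hpowD hpow1_order IHk htimes0h.
Qed.

(** * Multiples of a q-torsion element by classes modulo q *)

Section Torsion.
Variables (I : zmodType) (x : I).
Hypothesis q_x : x *+ q = 0.

Lemma mulrn_natr_H n : x *+ (n%:R : H) = x *+ n.
Proof.
rewrite val_Zp_nat ?order_gt1 // [in RHS](divn_eq n q) mulrnDr.
by rewrite mulnC mulrnA q_x mul0rn add0r.
Qed.

Lemma mulrn_addH (a b : H) : x *+ (a + b)%R = x *+ a + x *+ b.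
Proof.
have -> : a + b = (a + b)%N%:R by rewrite natrD !natr_Zp.
by rewrite mulrn_natr_H mulrnDr.
Qed.

Lemma mulrn_htimes1 (a : H) :
  x *+ (htimes 1 a)%R = x + x *+ a + x *+ a *+ (p ^ nu).
Proof.
have -> : htimes 1 a = (1 + a + a * p ^ nu)%N%:R.
  by rewrite /Defs.htimes !(natrD, natrM) natr_Zp mulr1 [_ * a]mulrC.
by rewrite mulrn_natr_H !mulrnDr mulr1n mulrnA.
Qed.

End Torsion.

Lemma iter_order_mod (T : Type) (f : T -> T) n y :
  (forall z, iter q f z = z) -> iter (n %% q) f y = iter n f y.
Proof.
move=> fq; rewrite [in RHS](divn_eq n q) addnC iterD; congr iter.
by elim: (n %/ q)%N => // k IHk; rewrite mulSn iterD -IHk fq.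
Qed.

Lemma iter_additiveD (I : zmodType) (A : {additive I -> I}) n :
  {morph iter n A : y z / y + z}.
Proof. by move=> y z; elim: n => //= n ->; rewrite raddfD. Qed.

(** * From endomorphisms satisfying (i) to the operations *)

Section FromEndomorphisms.
Variables (I : zmodType) (A B : {additive I -> I}).
Hypothesis AB_i : cond_i p nu eta A B.

Lemma iter_twist l y :
  iter l (fun z => A (z - B z)) y = iter l A (y - B y *+ (hpow 1 l)%R).
Proof.
have [_ qB comm] := AB_i.
elim: l y => [|l IHl] y; first by rewrite /= mulr0n subr0.
rewrite iterSr IHl [in RHS]iterSr; congr iter.
have -> : B (A (y - B y)) = A (B y) + A (B y) *+ (p ^ nu).
  rewrite !raddfB; apply/eqP; rewrite subr_eq -addrA [_ *+ _ + _]addrC.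
  by rewrite -comm addrC subrK.
(* With h = 1^{x l}, the coefficients 1, h and p^nu h of A (B y) add up to 1 x h. *)
rewrite /hpow iterS -/(hpow _ _) mulrn_htimes1 //.
by rewrite !(raddfB, raddfD, raddfMn) mulrnDl mulrnAC !addrA.
Qed.

(** The uniqueness clause expresses that (ii) defines the two operations. *)
Lemma action_of_endomorphisms :
  exists (dia : H -> I -> I) (prec : I -> H -> I),
    [/\ cond_ii nu A B dia prec,
        forall dia' prec', cond_ii nu A B dia' prec' ->
          dia' =2 dia /\ prec' =2 prec,
        cond_iii nu dia prec,
        cond_iv nu dia
      & cond_v nu dia prec].
Proof.
have [Aq qB comm] := AB_i.
have [log expK logK] := hpow1_bij.
(* [log] is the discrete logarithm to base 1 in (H, x). It is additive only modulo q, which is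
   harmless because A^q = Id. *)
pose dia (h : H) y := iter (log h) A y.
pose prec y (h : H) := B y *+ h.
have logM (h h' : H) : log (htimes h h') = (log h + log h')%N%:R.
  rewrite -[in LHS](logK h) -[in LHS](logK h') -hpowD -hpow1_mod.
  by rewrite -val_Zp_nat ?order_gt1 // expK.
have dia_tw h y : tri dia prec y h = iter (log h) (fun z => A (z - B z)) y.
  by rewrite iter_twist logK.
have diaD h : {morph dia h : y z / y + z} by exact: iter_additiveD.
have dia0 y : dia 0 y = y.
  by rewrite /dia (_ : log 0 = 0) //; exact: (expK 0).
have diaM h h' y : dia (htimes h' h) y = dia h (dia h' y).
  rewrite /dia logM val_Zp_nat ?order_gt1 // iter_order_mod // addnC.
  by rewrite iterD.
have ysupE y h : ysup nu dia prec y h = y - B y *+ h.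
  by rewrite /ysup /tri -diaM htimes_hinv dia0.
exists dia, prec; split.
- by split=> // l y; rewrite /dia expK.
- move=> dia' prec' [dia'E prec'E]; split=> [h y | y h]; last exact: prec'E.
  by rewrite -{1}(logK h) dia'E.
- split=> [y h h' | y y' h | y]; last 1 first.
  + by rewrite /tri dia0 /prec mulr0n subr0.
  + rewrite !dia_tw logM val_Zp_nat ?order_gt1 // iter_order_mod.
      by rewrite addnC iterD.
    (* T^q = Id as well: 1^{x q} = 0 reduces T^q to A^q. *)
    move=> z; rewrite iter_twist hpow1_order mulr0n subr0; exact: Aq.
  + by rewrite /tri -diaD /prec raddfD mulrnDl opprD addrACA.
- by split.
- split=> [y h h' | h]; last by rewrite ysupE raddf0 mul0rn subr0.
  by rewrite !ysupE mulrn_addH // opprD addrAC [RHS]addrACA.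
Qed.

End FromEndomorphisms.

(** * From the operations back to endomorphisms *)

Lemma endomorphisms_of_action (I : zmodType) (dia : H -> I -> I)
    (prec : I -> H -> I) :
  cond_iii nu dia prec -> cond_iv nu dia -> cond_v nu dia prec ->
  let A := fun y : I => dia 1 y in
  let B := fun y : I => prec y 1 in
  [/\ zmod_morphism A, zmod_morphism B, cond_i p nu eta A B
    & cond_ii nu A B dia prec].
Proof.
move=> [triM triD _] [diaM diaD dia0] [ysupD _] A B.
(* Each [dia h] is injective, so it can be cancelled in (iii) and (v) to isolate [prec]. *)
have diaK h : cancel (dia h) (dia (hinv h)).
  by move=> y; rewrite -diaM htimes_hinv dia0.
have dia_z h : dia h 0 = 0.
  by apply: (addrI (dia h 0)); rewrite -diaD !addr0.
have diaB h y z : dia h (y - z) = dia h y - dia h z.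
  by apply/eqP; rewrite eq_sym subr_eq -diaD subrK.
have precDr y h h' : prec y (h + h') = prec y h + prec y h'.
  have := ysupD y h h'; rewrite /ysup /tri !diaK.
  by rewrite addrAC [RHS]addrACA -opprD => /addrI/oppr_inj.
have prec0r y : prec y 0 = 0.
  by apply: (addrI (prec y 0)); rewrite -precDr !addr0.
have precMn y n : prec y n%:R = B y *+ n.
  by elim: n => [|n IHn]; rewrite ?prec0r // mulrSr precDr IHn mulrSr.
have precE y (h : H) : prec y h = B y *+ h by rewrite -{1}[h]natr_Zp precMn.
have precDl y y' h : prec (y + y') h = prec y h + prec y' h.
  have := triD y y' h; rewrite /tri -diaD => /(can_inj (diaK h)).
  by rewrite addrACA -opprD => /addrI/oppr_inj.
have precB y z : prec (y - z) 1 = prec y 1 - prec z 1.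
  by apply/eqP; rewrite eq_sym subr_eq -precDl subrK.
have diaE l y : dia (hpow 1 l) y = iter l A y.
  elim: l => [|l IHl]; rewrite ?dia0 //.
  by rewrite /hpow iterS htimesC diaM -/(hpow _ _) IHl.
split=> //; first exact: diaB.
split=> [y | y | y].
- by rewrite -diaE hpow1_order dia0.
(* q B y is y -< q, and q vanishes in H. *)
- by rewrite -precMn (eqP (_ : q%:R == 0 :> H)) ?natr_H_eq0.
have diaMn z n : dia 1 (z *+ n) = dia 1 z *+ n.
  by elim: n => [|n IHn]; rewrite ?mulr0n ?dia_z // !mulrSr diaD IHn.
(* Cancelling one A leaves A(y - (2 + p^nu) By) = A(y - By) - BA(y - By), which rearranges to the
   commutator relation. *)
have := triM y 1 1; rewrite /tri diaM => /(can_inj (diaK 1)).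
rewrite /Defs.htimes !mulr1 !precDr precMn !diaB !diaD diaMn precB.
rewrite -[RHS]addrA => /addrI; rewrite -opprD => /oppr_inj.
rewrite -!addrA => /addrI/esym/eqP; rewrite subr_eq => /eqP eq_BAy.
by rewrite /A /B eq_BAy addrAC [_ + _ *+ _]addrC addrK addrC.
Qed.

End CyclicGroup.

Theorem proposition2p7 (p nu eta : nat) (p_pr : prime p)
    (nu_gt0 : (0 < nu)%N) (le_nu_eta : (nu <= eta)%N)
    (le_eta_2nu : (eta <= 2 * nu)%N)
    (p_hyp : odd p \/ p = 2%N /\ (nu, eta) <> (1%N, 2%N))
    (I : zmodType) :
  (forall A B : {additive I -> I},
     cond_i p nu eta A B ->
     exists (dia : H p eta -> I -> I) (prec : I -> H p eta -> I),
       [/\ cond_ii nu A B dia prec,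
           forall dia' prec', cond_ii nu A B dia' prec' ->
             dia' =2 dia /\ prec' =2 prec,
           cond_iii nu dia prec,
           cond_iv nu dia
         & cond_v nu dia prec]) /\
  (forall (dia : H p eta -> I -> I) (prec : I -> H p eta -> I),
     cond_iii nu dia prec -> cond_iv nu dia -> cond_v nu dia prec ->
     let A := fun y : I => dia 1 y in
     let B := fun y : I => prec y 1 in
     [/\ zmod_morphism A, zmod_morphism B, cond_i p nu eta A B
       & cond_ii nu A B dia prec]).
Proof.
split=> [A B AB_i | dia prec]; first exact: action_of_endomorphisms.
exact: endomorphisms_of_action.
Qed.
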